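(* Let $M(x,\dot x)$ be a symmetric $n\times n$ matrix and consider the second-order system $$\frac{d}{dt}\big(M(x,\dot x)\,\dot x\big)=f(t,x,\dot x),\qquad x\in\mathbf{R}^n .$$ This system can be derived from a variational principle if, for all $i,j=1,\dots,n$, $$\sum_{k=1}^{n}\frac{\partial M_{ik}}{\partial \dot x_j}\dot x_k=\sum_{k=1}^{n}\frac{\partial M_{jk}}{\partial \dot x_i}\dot x_k,$$ $$\sum_{k=1}^{n}\Big(\frac{\partial M_{ik}}{\partial x_j}+\frac{\partial M_{jk}}{\partial x_i}\Big)\dot x_k=\frac{\partial f_i}{\partial \dot x_j}+\frac{\partial f_j}{\partial \dot x_i},$$ $$\sum_{k=1}^{n}\frac{d}{dt}\Big(\frac{\partial M_{ik}}{\partial x_j}\dot x_k\Big)=\frac{\partial f_i}{\partial x_j}-\frac{\partial f_j}{\partial x_i}+\frac{d}{dt}\frac{\partial f_j}{\partial \dot x_i}.$$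
   Context: $M$ and $f$ are smooth. The identities are required to hold identically in $t,x,\dot x,\ddot x$, and $\frac{d}{dt}$ is the total derivative along a curve: $\frac{d}{dt}=\partial_t+\sum_k\dot x_k\partial_{x_k}+\sum_k\ddot x_k\partial_{\dot x_k}+\cdots$. Write $N[x]=\frac{d}{dt}(M(x,\dot x)\dot x)-f(t,x,\dot x)$. The system $N[x]=0$ ''can be derived from a variational principle'' if there is a Lagrangian $L[x]$ (a function of $t$, $x$ and finitely many time derivatives of $x$) whose Euler–Lagrange expression for the action $\int L[x]\,dt$ is $N[x]$ (up to an overall sign), so that $N[x]=0$ is its Euler–Lagrange equation. *)

(* Defs.v *)
From mathcomp Require Import all_boot all_order all_algebra.
From mathcomp Require Import all_classical all_reals all_analysis.

Set Implicit Arguments.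
Unset Strict Implicit.
Unset Printing Implicit Defensive.

Import Order.TTheory GRing.Theory Num.Theory.
Import numFieldNormedType.Exports.
Local Open Scope ring_scope.

(* This is the usual notion of C^k map when V is finite-dimensional, the only
   case used here. *)
Fixpoint class_C (R : realType) (V W : normedModType R) (k : nat)
    (F : V -> W) : Prop :=
  match k with
  | 0 => continuous F
  | k'.+1 => (forall p, differentiable F p) /\
             (forall v, class_C k' (fun p => 'D_v F p))
  end.

Definition smooth (R : realType) (V W : normedModType R) (F : V -> W) : Prop :=
  forall k, class_C k F.

Section JetCalculus.
Context {R : realType} {n : nat}.

Definition partial (j : 'I_n) (g : 'cV[R]_n -> R) (x : 'cV[R]_n) : R :=
  'D_(delta_mx j 0) g x.

(* The m-jet (x, x', ..., x^(m)) of a curve in R^n is encoded as the matrix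
   whose column l is the l-th time derivative; a function of t, x and m time
   derivatives of x is thus a function R -> 'M[R]_(n, m.+1) -> R. *)
Definition jet (m : nat) (u : nat -> 'cV[R]_n) : 'M[R]_(n, m.+1) :=
  \matrix_(i < n, l < m.+1) u l i 0.

Definition jet_partial (m : nat) (i : 'I_n) (l : 'I_m.+1)
    (F : R -> 'M[R]_(n, m.+1) -> R) : R -> 'M[R]_(n, m.+1) -> R :=
  fun t w => 'D_(delta_mx i l) (F t) w.

(* d/dt = d_t + sum_(l <= m) sum_k x_k^(l+1) d/dx_k^(l) *)
Definition total_derivative (m : nat) (F : R -> 'M[R]_(n, m.+1) -> R) :
    R -> 'M[R]_(n, m.+2) -> R :=
  fun t w =>
    let w' := \matrix_(i < n, l < m.+1) w i (widen_ord (leqnSn m.+1) l) in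
    'D_1 (fun s => F s w') t
    + \sum_(l < m.+1) \sum_(k < n)
        w k (lift ord0 l) * jet_partial k l F t w'.

Fixpoint iter_total_derivative (m l : nat) (F : R -> 'M[R]_(n, m.+1) -> R) :
    R -> 'M[R]_(n, (l + m).+1) -> R :=
  match l return R -> 'M[R]_(n, (l + m).+1) -> R with
  | 0 => F
  | l'.+1 => total_derivative (@iter_total_derivative m l' F)
  end.

Arguments iter_total_derivative {m} l F.

(* sum_(l <= m) (-d/dt)^l (dL/dx_i^(l)); u is the sequence x, x', x'', ... of
   all derivatives, since the terms of the sum have different orders. *)
Definition euler_lagrange (m : nat) (L : R -> 'M[R]_(n, m.+1) -> R)
    (i : 'I_n) (t : R) (u : nat -> 'cV[R]_n) : R :=
  \sum_(l < m.+1)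
    (-1) ^+ l * iter_total_derivative l (jet_partial i l L) t (jet (l + m) u).

Definition derivable_from_variational_principle
    (N : R -> 'cV[R]_n -> 'cV[R]_n -> 'cV[R]_n -> 'cV[R]_n) : Prop :=
  exists (m : nat) (L : R -> 'M[R]_(n, m.+1) -> R),
    smooth (fun p : R * 'M[R]_(n, m.+1) => L p.1 p.2) /\
    ((forall i t u,
        euler_lagrange L i t u = N t (u 0%N) (u 1%N) (u 2%N) i 0) \/
     (forall i t u,
        euler_lagrange L i t u = - N t (u 0%N) (u 1%N) (u 2%N) i 0)).

(* The total derivative of g(t, x, x') at x' = v, x'' = a. *)
Definition ddt (g : R -> 'cV[R]_n -> 'cV[R]_n -> R)
    (t : R) (x v a : 'cV[R]_n) : R :=
  total_derivative (fun s (w : 'M[R]_(n, 2)) => g s (col ord0 w) (col ord_max w))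
    t (jet 2 (nth 0 [:: x; v; a])).

(* N[x] = d/dt (M(x, x') x') - f(t, x, x') *)
Definition second_order_system (M : 'cV[R]_n -> 'cV[R]_n -> 'M[R]_n)
    (f : R -> 'cV[R]_n -> 'cV[R]_n -> 'cV[R]_n)
    (t : R) (x v a : 'cV[R]_n) : 'cV[R]_n :=
  \col_i (ddt (fun _ y w => (M y w *m w) i 0) t x v a - f t x v i 0).

End JetCalculus.

(* Main.v *)
Require Import Defs.
From HB Require Import structures.
From mathcomp Require Import all_boot all_order all_algebra.
From mathcomp Require Import all_classical all_reals all_analysis.
From mathcomp Require Import ring lra.

(** The hypotheses H1, H2 and H3 are the Helmholtz conditions of the second-order
    expression N_i = d/dt P_i - f_i with momenta P_i = sum_k M_ik v_k: by the
    symmetry of M, H1 says that dP_i/dv_j is symmetric in i and j,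
    H2 that
      dP_i/dx_j + dP_j/dx_i = df_i/dv_j + df_j/dv_i,
    and H3 that
      d/dt (dP_i/dx_j) = df_i/dx_j - df_j/dx_i + d/dt (df_j/dv_i).
    A Lagrangian whose Euler-Lagrange expression is - N can be written down
    explicitly, and it depends on t, x and v = x' only.

    Since dP_i/dv_j is symmetric, integrating along the velocities gives K
    with dK/dv_i = P_i (momentum_potential). The Euler-Lagrange expression
    of K is dK/dx_i - d/dt P_i, so it is enough to find U whose expression is
    the remaining force g_i = f_i - dK/dx_i. H2 becomes
      dg_i/dv_j = - dg_j/dv_i
    and H3 becomes
      d/dt (dg_i/dv_j) = dg_i/dx_j - dg_j/dx_i,
    that is, the linearization of g is self-adjoint. So U is given by the
    integral over s in [0, 1] of sum_j x_j g_j (t, s x, s v)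
    (first_order_potential), and the Lagrangian is L = K + U (helmholtz_lagrangian).

    The analytic input is the calculus of integrals over s in [0, 1] of
    s ^+ k * F (A p + s *: B p), for linear maps A and B: these ray means are
    smooth in p when F is smooth, with the expected derivatives
    (smooth_ray_mean, derive_smooth_ray_mean). Commutation of second
    derivatives (derive_comm) also follows from this calculus. Finally all
    partial and total derivatives are read as directional derivatives on the
    space of jets (t, x, v); the total derivative is the derivative along a
    vector (1, v, a), which makes its Leibniz rule and its commutation with
    the integrals immediate (total_derivativeE, ddt_contact,
    derive_contact_dilation_mean). *)

Set Implicit Arguments.
Unset Strict Implicit.
Unset Printing Implicit Defensive.

Import Order.TTheory GRing.Theory Num.Theory.
Import numFieldNormedType.Exports.
Local Open Scope ring_scope.

(** * Smooth maps and directional derivatives *)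

Section ClassC.
Context {R : realType}.
Implicit Types U V W : normedModType R.

Lemma class_C_continuous V W k (F : V -> W) : class_C k F -> continuous F.
Proof.
by case: k => [//|k] [dF _] p; apply: differentiable_continuous.
Qed.

Lemma class_C_pred V W k (F : V -> W) : class_C k.+1 F -> class_C k F.
Proof.
elim: k F => [|k IH] F [dF DF]; first exact: (@class_C_continuous _ _ 1).
by split=> // v; exact/IH/DF.
Qed.

Lemma smooth_differentiable V W (F : V -> W) p : smooth F -> differentiable F p.
Proof. by move=> /(_ 1)[]. Qed.

Lemma smooth_derivable V W (F : V -> W) p v : smooth F -> derivable F p v.
Proof. by move=> /smooth_differentiable/diff_derivable; apply. Qed.

Lemma smooth_continuous V W (F : V -> W) : smooth F -> continuous F.
Proof. by move=> /(_ 0). Qed.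

Lemma smooth_derive V W (F : V -> W) v : smooth F -> smooth ('D_v F).
Proof. by move=> sF k; have [_] := sF k.+1; exact. Qed.

Lemma class_C_cst V W k (a : W) : class_C k (fun _ : V => a).
Proof.
elim: k a => [|k IH] a /=; first by move=> ?; exact: cst_continuous.
split=> [p|v]; first exact: differentiable_cst.
rewrite (_ : (fun p => 'D_v _ p) = (fun=> 0)); first exact: IH.
by apply/funext => p; exact: derive_cst.
Qed.

Lemma class_C_linear V W k (f : {linear V -> W}) : continuous f -> class_C k f.
Proof.
case: k => [//|k] cf; split=> [p|v]; first exact: linear_differentiable.
rewrite (_ : (fun p => 'D_v _ p) = (fun=> f v)); first exact: class_C_cst.
by apply/funext => p; rewrite deriveE ?diff_lin//; exact: linear_differentiable.
Qed.

Lemma class_C_add V W k (F G : V -> W) :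
  class_C k F -> class_C k G -> class_C k (fun p => F p + G p).
Proof.
elim: k F G => [|k IH] F G cF cG; first by move=> p; exact: (continuousD (cF p) (cG p)).
case: cF cG => [dF DF] [dG DG]; split=> [p|v]; first exact: differentiableD.
rewrite (_ : (fun p => 'D_v _ p) = (fun p => 'D_v F p + 'D_v G p)).
  exact: IH (DF v) (DG v).
by apply/funext => p; rewrite deriveD//; exact: diff_derivable.
Qed.

Lemma class_C_mul V k (F G : V -> R) :
  class_C k F -> class_C k G -> class_C k (fun p => F p * G p).
Proof.
elim: k F G => [|k IH] F G cF cG.
  by move=> p; exact: (continuousM (cF p) (cG p)).
have [cF' cG'] := (class_C_pred cF, class_C_pred cG).
case: cF cG => [dF DF] [dG DG]; split=> [p|v]; first exact: differentiableM.
rewrite (_ : (fun p => 'D_v _ p) = (fun p => F p * 'D_v G p + G p * 'D_v F p)).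
  exact: class_C_add (IH _ _ cF' (DG v)) (IH _ _ cG' (DF v)).
by apply/funext => p; rewrite deriveM//; exact: diff_derivable.
Qed.

Lemma derive_linear V W (f : {linear V -> W}) p v : continuous f -> 'D_v f p = f v.
Proof. by move=> cf; rewrite deriveE ?diff_lin//; exact: linear_differentiable. Qed.

Lemma derive_dirD V W (F : V -> W) p u v : differentiable F p ->
  'D_(u + v) F p = 'D_u F p + 'D_v F p.
Proof. by move=> dF; rewrite !deriveE// linearD. Qed.

Lemma derive_dirZ V W (F : V -> W) p a v : differentiable F p ->
  'D_(a *: v) F p = a *: 'D_v F p.
Proof. by move=> dF; rewrite !deriveE// linearZ. Qed.

Lemma derive_dir_sum V W (F : V -> W) (I : finType) p (a : I -> R) (e : I -> V) :
  differentiable F p ->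
  'D_(\sum_i a i *: e i) F p = \sum_i a i *: 'D_(e i) F p.
Proof.
move=> dF; rewrite deriveE// linear_sum; apply: eq_bigr => i _.
by rewrite linearZ deriveE.
Qed.

Lemma is_derive_line U V W (F : V -> W) (G : U -> W) p q v w :
  (forall h : R, F (h *: v + p) = G (h *: w + q)) -> derivable G q w ->
  is_derive p v F ('D_w G q).
Proof.
move=> FG dG.
have E : (fun h => h^-1 *: ((F \o shift p) (h *: v) - F p)) =
         (fun h => h^-1 *: ((G \o shift q) (h *: w) - G q)).
  by apply/funext => h /=; have := FG 0; rewrite !scale0r !add0r FG => ->.
by split; [rewrite /derivable E|rewrite /derive E].
Qed.

(** A directional derivative sees a map only through its restriction to one
    affine line. Partial derivatives of maps of several arguments, with the
    other arguments frozen, are in this way the derivatives of one uncurried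
    map, whether or not the latter is differentiable. *)
Lemma derive_line U V W (F : V -> W) (G : U -> W) p q v w :
  (forall h : R, F (h *: v + p) = G (h *: w + q)) -> 'D_v F p = 'D_w G q.
Proof.
move=> FG; rewrite /derive.
suff -> : (fun h => h^-1 *: ((F \o shift p) (h *: v) - F p)) =
          (fun h => h^-1 *: ((G \o shift q) (h *: w) - G q)) by [].
by apply/funext => h /=; have := FG 0; rewrite !scale0r !add0r FG => ->.
Qed.

Lemma is_derive_affine V W (F : V -> W) p u (a : R) :
  differentiable F (a *: u + p) ->
  is_derive a 1 (fun b : R => F (b *: u + p)) ('D_u F (a *: u + p)).
Proof.
move=> dF; apply: is_derive_line; last exact: diff_derivable.
by move=> h; rewrite [h *: 1]mulr1 scalerDl addrA.
Qed.

Lemma class_C_comp_linear U V W k (f : {linear U -> V}) (F : V -> W) :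
  continuous f -> class_C k F -> class_C k (F \o f).
Proof.
move=> cf; elim: k F => [|k IH] F cF.
  by move=> p; apply: continuous_comp; [exact: cf|exact: cF].
case: cF => dF DF.
have df p : differentiable f p by exact: linear_differentiable.
split=> [p|v]; first exact: differentiable_comp.
rewrite (_ : (fun p => 'D_v _ p) = ('D_(f v) F) \o f); first exact/IH/DF.
by apply/funext => p /=; apply: derive_line => h /=; rewrite linearP.
Qed.

Lemma class_C_linear_comp U V W k (f : {linear V -> W}) (F : U -> V) :
  continuous f -> class_C k F -> class_C k (f \o F).
Proof.
move=> cf; elim: k F => [|k IH] F cF.
  by move=> p; apply: continuous_comp; [exact: cF|exact: cf].
case: cF => dF DF.
have df p : differentiable f p by exact: linear_differentiable.
split=> [p|v]; first exact: differentiable_comp.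
rewrite (_ : (fun p => 'D_v _ p) = f \o ('D_v F)); first exact/IH/DF.
apply/funext => p /=; rewrite (deriveE v (dF p)).
rewrite (deriveE v (differentiable_comp (dF p) (df (F p)))).
by rewrite (diff_comp (dF p) (df (F p))) /= (diff_lin _ cf).
Qed.

Lemma smooth_add V W (F G : V -> W) :
  smooth F -> smooth G -> smooth (fun p => F p + G p).
Proof. by move=> sF sG k; exact: class_C_add. Qed.

Lemma smooth_mul V (F G : V -> R) :
  smooth F -> smooth G -> smooth (fun p => F p * G p).
Proof. by move=> sF sG k; exact: class_C_mul. Qed.

Lemma smooth_sub V (F G : V -> R) :
  smooth F -> smooth G -> smooth (fun p => F p - G p).
Proof.
move=> sF sG; under eq_fun do rewrite -mulN1r.
by apply: smooth_add => //; apply: smooth_mul => // k; exact: class_C_cst.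
Qed.

Lemma smooth_sum V W (I : finType) (F : I -> V -> W) :
  (forall i, smooth (F i)) -> smooth (fun p => \sum_i F i p).
Proof.
move=> sF; rewrite /index_enum; elim: (Finite.enum I) => [|i r IH].
  by under eq_fun do rewrite big_nil; move=> k; exact: class_C_cst.
by under eq_fun do rewrite big_cons; exact: smooth_add.
Qed.

Lemma derive_smooth_add V W (F G : V -> W) p v : smooth F -> smooth G ->
  'D_v (fun q => F q + G q) p = 'D_v F p + 'D_v G p.
Proof. by move=> sF sG; rewrite deriveD//; exact: smooth_derivable. Qed.

Lemma derive_smooth_sub V (F G : V -> R) p v : smooth F -> smooth G ->
  'D_v (fun q => F q - G q) p = 'D_v F p - 'D_v G p.
Proof. by move=> sF sG; rewrite deriveB//; exact: smooth_derivable. Qed.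

Lemma derive_smooth_mul V (F G : V -> R) p v : smooth F -> smooth G ->
  'D_v (fun q => F q * G q) p = F p * 'D_v G p + 'D_v F p * G p.
Proof.
move=> sF sG; rewrite deriveM; [|exact: smooth_derivable..].
by rewrite [_ *: 'D_v F p]mulrC.
Qed.

Lemma derive_smooth_sum V W (I : finType) (F : I -> V -> W) p v :
  (forall i, smooth (F i)) ->
  'D_v (fun q => \sum_i F i q) p = \sum_i 'D_v (F i) p.
Proof.
move=> sF; rewrite /index_enum; elim: (Finite.enum I) => [|i r IH].
  by under eq_fun do rewrite big_nil; rewrite big_nil derive_cst.
under eq_fun do rewrite big_cons.
rewrite big_cons -IH deriveD//; first exact: smooth_derivable.
apply/diff_derivable; elim: r {IH} => [|j r IH].
  by under eq_fun do rewrite big_nil; exact: differentiable_cst.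
under eq_fun do rewrite big_cons.
by apply: differentiableD => //; exact: smooth_differentiable.
Qed.

Lemma smooth_linear V W (f : {linear V -> W}) : continuous f -> smooth f.
Proof. by move=> cf k; exact: class_C_linear. Qed.

End ClassC.

(** * Means over the unit interval *)

(** Locked, so that unification never has to compare two integrals by
    unfolding them. *)
HB.lock Definition mean (R : realType) (phi : R -> R) : R :=
  (\int[lebesgue_measure]_(s in `[0, 1]%classic) phi s)%R.

Section Mean.
Context {R : realType}.
Implicit Types phi psi : R -> R.
Local Open Scope classical_set_scope.

Lemma mean_integrable phi : continuous phi ->
  lebesgue_measure.-integrable `[0 : R, 1] (EFin \o phi).
Proof.
move=> cphi; apply: continuous_compact_integrable; first exact: segment_compact.
exact: continuous_subspaceT.
Qed.

Lemma eq_mean phi psi : phi =1 psi -> mean phi = mean psi.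
Proof. by move=> /funext ->. Qed.

Lemma meanD phi psi : continuous phi -> continuous psi ->
  mean (fun s => phi s + psi s) = mean phi + mean psi.
Proof. by move=> cphi cpsi; rewrite mean.unlock RintegralD//; exact: mean_integrable. Qed.

Lemma meanB phi psi : continuous phi -> continuous psi ->
  mean (fun s => phi s - psi s) = mean phi - mean psi.
Proof. by move=> cphi cpsi; rewrite mean.unlock RintegralB//; exact: mean_integrable. Qed.

Lemma meanZ (a : R) phi : continuous phi -> mean (fun s => a * phi s) = a * mean phi.
Proof. by move=> cphi; rewrite mean.unlock RintegralZl//; exact: mean_integrable. Qed.

Lemma mean_bound phi (c : R) : continuous phi ->
  (forall s, s \in `[0, 1]%R -> `|phi s| <= c) -> `|mean phi| <= c.
Proof.
move=> cphi phic; rewrite mean.unlock.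
apply: (le_trans (le_normr_Rintegral _ (mean_integrable cphi))) => //.
have -> : c = \int[lebesgue_measure]_(s in `[0 : R, 1]) c.
  have := @lebesgue_measure_itv R `[0, 1]%R; rewrite /= lte_fin ltr01 -EFinB subr0.
  move=> mu01; rewrite Rintegral_cst// -[LHS]mulr1; congr (_ * _).
  by rewrite -[LHS]/(fine 1%:E) -mu01.
apply: le_Rintegral => //.
- apply: mean_integrable => x; apply: (continuous_comp (cphi x)); exact: norm_continuous.
- by apply: mean_integrable => x; exact: cst_continuous.
Qed.

Lemma mean_derive (Phi phi : R -> R) : continuous phi ->
  (forall s : R, is_derive s 1 Phi (phi s)) -> mean phi = Phi 1 - Phi 0.
Proof.
move=> cphi dPhi.
have cPhi : continuous Phi.
  by move=> s; apply/differentiable_continuous/derivable1_diffP; have [] := dPhi s.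
rewrite mean.unlock /Rintegral (@continuous_FTC2 _ _ Phi) //.
- exact: continuous_subspaceT.
- split; first by move=> s _; have [] := dPhi s.
  + exact/cvg_at_right_filter/cPhi.
  + exact/cvg_at_left_filter/cPhi.
- by move=> s _; rewrite derive1E; have [] := dPhi s.
Qed.

End Mean.

(** * Means along rays, and differentiation under the integral sign *)
Section RayMean.
Context {R : realType} {V E : normedModType R}.
Variables (A B : {linear V -> E}).
Hypotheses (cA : continuous A) (cB : continuous B).
Local Open Scope classical_set_scope.

Definition ray (s : R) (p : V) : E := A p + s *: B p.

Lemma rayD s p q : ray s (p + q) = ray s p + ray s q.
Proof. by rewrite /ray !linearD addrACA. Qed.

Lemma rayZ s (a : R) p : ray s (a *: p) = a *: ray s p.
Proof. by rewrite /ray scalerDr ![_ (a *: p)]linearZ/= !scalerA mulrC. Qed.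

Lemma ray_continuous : continuous (fun x : R * V => ray x.1 x.2).
Proof.
move=> x; have c2 : x0.2 @[x0 --> x] --> x.2 by exact: cvg_snd.
apply: cvgD; first by apply: (cvg_comp snd A c2); exact: cA.
by apply: cvgZ; [exact: cvg_fst|apply: (cvg_comp snd B c2); exact: cB].
Qed.

(** The weights s ^+ k make this family of integrals closed under
    differentiation: differentiating the integrand brings out a factor s in
    the directions of B (derive_ray_mean). Smoothness then follows by
    induction on the order of differentiability. *)
Definition ray_mean (k : nat) (F : E -> R) (p : V) : R :=
  mean (fun s => s ^+ k * F (ray s p)).

Lemma ray_integrand_continuous2 k (F : E -> R) : continuous F ->
  continuous (fun x : R * V => x.1 ^+ k * F (ray x.1 x.2)).
Proof.
move=> cF x; have c1 : x0.1 @[x0 --> x] --> x.1 by exact: cvg_fst.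
apply: cvgM.
  by apply: (cvg_comp fst (fun s : R => s ^+ k) c1); exact: exprn_continuous.
by apply: (cvg_comp (fun x : R * V => ray x.1 x.2) F (@ray_continuous x)); exact: cF.
Qed.

Lemma ray_integrand_continuous k (F : E -> R) p : continuous F ->
  continuous (fun s : R => s ^+ k * F (ray s p)).
Proof.
move=> cF s.
have cs : (s', p) @[s' --> s] --> (s, p)
    by exact: (@cvg_pair _ _ _ (nbhs s) (nbhs s) (nbhs p) _ _ _ id (cst p)
                 cvg_id (cvg_cst p)).
apply: (cvg_comp _ (fun x : R * V => x.1 ^+ k * F (ray x.1 x.2)) cs).
exact: (@ray_integrand_continuous2 k F cF (s, p)).
Qed.

(** The tube lemma: continuity at the points of the compact segment
    [0, 1] x {p} is uniform in the first variable. *)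
Lemma uniform_near (g : R * V -> R) p (e : R) : continuous g -> 0 < e ->
  \forall q \near p, forall s, s \in `[0, 1]%R -> `|g (s, q) - g (s, p)| <= e.
Proof.
move=> cg e0.
have /compact_near_coveringP cov := @segment_compact R 0 1.
suff : \forall q \near p, `[0, 1] `<=` (fun s => `|g (s, q) - g (s, p)| <= e).
  by apply: filterS => q H s s01; exact: H.
apply: (cov V (nbhs p) (fun q s => `|g (s, q) - g (s, p)| <= e)) => s _.
have e20 : 0 < e / 2 by rewrite divr_gt0.
have /cvgrPdist_le/(_ _ e20) cgs := cg (s, p).
have cgp : \forall s' \near s, `|g (s, p) - g (s', p)| <= e / 2.
  have : (fun s' => g (s', p)) @ s --> g (s, p).
    have cs : (s', p) @[s' --> s] --> (s, p)
    by exact: (@cvg_pair _ _ _ (nbhs s) (nbhs s) (nbhs p) _ _ _ id (cst p)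
                 cvg_id (cvg_cst p)).
    by apply: (cvg_comp _ g cs); exact: cg.
  by move=> /cvgrPdist_le; apply.
have cgp2 : \forall x \near (s, p), `|g (s, p) - g (x.1, p)| <= e / 2.
  exists ([set s' | `|g (s, p) - g (s', p)| <= e / 2], setT) => /=.
    by split; [exact: cgp|exact: filterT].
  by move=> [a b] [].
have [[U W] /= nUW sUW] := filterI cgs cgp2.
exists (U, W) => // -[s' q] /sUW[/= h1 h2].
by rewrite (le_trans (ler_distD (g (s, p)) _ _))// [leRHS]splitr lerD// distrC.
Qed.

Lemma ray_mean_continuous k (F : E -> R) : continuous F -> continuous (ray_mean k F).
Proof.
move=> cF p; apply/cvgrPdist_le => e e0.
have U := uniform_near p (@ray_integrand_continuous2 k F cF) e0.
near=> q; have H := near U q.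
have ci q' := @ray_integrand_continuous k F q' cF.
rewrite distrC -meanB//; apply: mean_bound => [s|s s01]; last exact: H.
exact: (cvgB (ci q s) (ci p s)).
Unshelve. all: by end_near.
Qed.

Lemma ray_lipschitz : exists2 C : R, 0 < C &
  forall s h, s \in `[0, 1]%R -> `|ray s h| <= C * `|h|.
Proof.
have [a a0 Ha] := linear_lipschitz cA; have [b b0 Hb] := linear_lipschitz cB.
exists (a + b) => [|s h]; first exact: addr_gt0.
rewrite in_itv/= => /andP[s0 s1]; rewrite mulrDl (le_trans (ler_normD _ _))// lerD//.
by rewrite normrZ ger0_norm// (le_trans _ (Hb _))// ler_piMl.
Qed.

(** A finite frame with bounded coordinates. It is what turns the continuity of
    each single directional derivative, the form of continuity in class_C,
    into continuity of the differential in operator norm. *)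
Variables (I : finType) (e : I -> E) (c : I -> E -> R).
Hypothesis ec : forall h, h = \sum_i c i h *: e i.
Hypothesis c_le : forall i h, `|c i h| <= `|h|.

(** By the mean value theorem the remainder is the variation of 'D_(ray s h) F
    along a segment. In the frame this is a combination of the variations of
    finitely many directional derivatives, each small uniformly in s by
    uniform_near, with coefficients at most C * `|h|. *)
Lemma ray_remainder (F : E -> R) p (eps : R) : (forall q, differentiable F q) ->
  (forall v, continuous ('D_v F)) -> 0 < eps ->
  \forall h \near (0 : V), forall s, s \in `[0, 1]%R ->
    `|F (ray s (h + p)) - F (ray s p) - 'D_(ray s h) F (ray s p)| <= eps * `|h|.
Proof.
move=> dF cDF eps0; have [C C0 rC] := ray_lipschitz.
(* #|I|.+1 rather than #|I|, to divide by a nonzero number for an empty frame. *)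
have N0 : 0 < C * #|I|.+1%:R by rewrite mulr_gt0.
pose d := eps / (C * #|I|.+1%:R); have d0 : 0 < d by rewrite divr_gt0.
have cg i : continuous (fun x : R * V => 'D_(e i) F (ray x.1 x.2)).
  move=> x.
  apply: (cvg_comp (fun x : R * V => ray x.1 x.2) ('D_(e i) F) (@ray_continuous x)).
  exact: cDF.
have Hn : \forall q \near p, forall i s, s \in `[0, 1]%R ->
    `|'D_(e i) F (ray s q) - 'D_(e i) F (ray s p)| <= d.
  exact: (filter_forall _ (fun i => uniform_near p (cg i) d0)).
have [r /= r0 Hr] := (nbhs_normP _ _).1 Hn.
apply/nbhs_norm0P; exists r => //= h hr s s01.
(* The linear part is subtracted so that one application of the mean value
   theorem bounds the whole remainder. *)
pose phi (a : R) := F (a *: ray s h + ray s p) - a * 'D_(ray s h) F (ray s p).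
have dphi (a : R) : is_derive a 1 phi
    ('D_(ray s h) F (a *: ray s h + ray s p) - 'D_(ray s h) F (ray s p)).
  rewrite /phi; apply: is_deriveB; first exact: is_derive_affine.
  set m := 'D_(ray s h) F (ray s p).
  apply: (is_derive_eq (is_deriveM (is_derive_id a 1) (is_derive_cst m a 1))).
  by rewrite scaler0 add0r; exact: mulr1.
have cphi : {within `[0, 1], continuous phi}.
  by apply: derivable_within_continuous => a _; have [] := dphi a.
have [a a01] := MVT ltr01 (fun a _ => dphi a) cphi.
rewrite /phi scale1r mul1r scale0r mul0r subr0 add0r subr0 mulr1 -rayD addrAC => ->.
rewrite -rayZ -rayD {1 2}[ray s h]ec !derive_dir_sum// -sumrB.
have kd : C * `|h| * d *+ #|I| <= eps * `|h|.
  rewrite /d -mulr_natl invfM.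
  have -> : #|I|%:R * (C * `|h| * (eps * (C^-1 * #|I|.+1%:R^-1))) =
    (#|I|%:R / #|I|.+1%:R) * (eps * `|h|) by field; rewrite gt_eqF//= gt_eqF.
  have q1 : #|I|%:R / #|I|.+1%:R <= 1 :> R by rewrite ler_pdivrMr// mul1r ler_nat.
  by rewrite ler_piMl// mulr_ge0// ltW.
apply: le_trans (ler_norm_sum _ _ _) (le_trans _ kd).
rewrite -sumr_const; apply: ler_sum => i _.
rewrite -scalerBr normrM ler_pM//.
  by rewrite (le_trans (c_le _ _))// rC.
apply: Hr => //=; rewrite opprD addrCA subrr addr0 normrN normrZ.
move: a01; rewrite in_itv/= => /andP[a0 a1].
by rewrite gtr0_norm// (le_lt_trans _ hr)// ler_piMl// ltW.
Qed.

Lemma ray_meanD k (F G : E -> R) p : continuous F -> continuous G ->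
  ray_mean k (fun q => F q + G q) p = ray_mean k F p + ray_mean k G p.
Proof.
move=> cF cG; rewrite /ray_mean -meanD; try exact: ray_integrand_continuous.
by apply: eq_mean => s; rewrite mulrDr.
Qed.

Lemma ray_meanZ k (a : R) (F : E -> R) p : continuous F ->
  ray_mean k (fun q => a * F q) p = a * ray_mean k F p.
Proof.
move=> cF; rewrite /ray_mean -meanZ; try exact: ray_integrand_continuous.
by apply: eq_mean => s; rewrite mulrCA.
Qed.

Section DifferentiateRayMean.
Variables (k : nat) (F : E -> R) (p : V).
Hypotheses (dF : forall q, differentiable F q) (cDF : forall v, continuous ('D_v F)).

(** The differential of ray_mean k F at p. *)
Definition dray_mean (h : V) : R :=
  ray_mean k ('D_(A h) F) p + ray_mean k.+1 ('D_(B h) F) p.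

Lemma dray_integrandE h (s : R) : s ^+ k * 'D_(ray s h) F (ray s p) =
  s ^+ k * 'D_(A h) F (ray s p) + s ^+ k.+1 * 'D_(B h) F (ray s p).
Proof. by rewrite {1}/ray derive_dirD// derive_dirZ// mulrDr exprSr mulrA. Qed.

Lemma dray_meanE h :
  dray_mean h = mean (fun s => s ^+ k * 'D_(ray s h) F (ray s p)).
Proof.
rewrite /dray_mean /ray_mean -meanD.
- by apply: eq_mean => s; rewrite dray_integrandE.
- exact: (@ray_integrand_continuous k _ p (@cDF (A h))).
- exact: (@ray_integrand_continuous k.+1 _ p (@cDF (B h))).
Qed.

Lemma dray_mean_linear : linear dray_mean.
Proof.
have cZD k' (u v : E) (a : R) : ray_mean k' ('D_(a *: u + v) F) p =
    a * ray_mean k' ('D_u F) p + ray_mean k' ('D_v F) p.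
  have caD : continuous (fun q => a * 'D_u F q).
    by move=> q; apply: cvgM; [exact: cvg_cst|exact: cDF].
  rewrite -ray_meanZ// -ray_meanD//; congr (ray_mean _ _ _); apply/funext => q.
  by rewrite derive_dirD// derive_dirZ.
move=> a u v; rewrite /dray_mean.
have -> : A (a *: u + v) = a *: A u + A v by exact: linearP.
have -> : B (a *: u + v) = a *: B u + B v by exact: linearP.
by rewrite (cZD k) (cZD k.+1) -[a *: _]/(a * _) mulrDr addrACA.
Qed.

Lemma ray_mean_remainder (eps : R) : 0 < eps ->
  \forall h \near (0 : V),
    `|ray_mean k F (h + p) - ray_mean k F p - dray_mean h| <= eps * `|h|.
Proof.
move=> eps0; have U := ray_remainder p dF cDF eps0.
have cF : continuous F by move=> q; exact: differentiable_continuous.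
near=> h; have H := near U h.
have c1 q := @ray_integrand_continuous k F q cF.
have c2 : continuous (fun s : R => s ^+ k * 'D_(ray s h) F (ray s p)).
  move=> s; under eq_fun do rewrite dray_integrandE.
  exact: (cvgD (@ray_integrand_continuous k _ p (@cDF (A h)) s)
               (@ray_integrand_continuous k.+1 _ p (@cDF (B h)) s)).
rewrite dray_meanE -!meanB//.
  apply: mean_bound => [s|s s01].
    by apply: cvgB; [exact: (cvgB (c1 (h + p) s) (c1 p s))|exact: c2].
  rewrite -!mulrBr normrM -[leRHS]mul1r ler_pM//; last exact: H.
  move: s01; rewrite in_itv/= => /andP[s0 s1].
  by rewrite normrX ger0_norm// exprn_ile1.
by move=> s; exact: (cvgB (c1 (h + p) s) (c1 p s)).
Unshelve. all: by end_near.
Qed.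

HB.instance Definition _ := GRing.isLinear.Build R V R _ dray_mean dray_mean_linear.

(** Continuity at 0 comes for free from the first-order expansion, because the
    increments of ray_mean are already known to be small. *)
Lemma dray_mean_continuous : continuous dray_mean.
Proof.
have cF : continuous F by move=> q; exact: differentiable_continuous.
apply: continuousfor0_continuous; rewrite /prop_for/continuous_at linear0.
apply/cvgr0Pnorm_le => eps eps0; have e2 : 0 < eps / 2 by rewrite divr_gt0.
have U1 := ray_mean_remainder ltr01.
have U2 : \forall h \near (0 : V), `|ray_mean k F (h + p) - ray_mean k F p| <= eps / 2.
  have /cvgrPdist_le/(_ _ e2)/nbhs0P := @ray_mean_continuous k F cF p.
  by apply: filterS => h; rewrite [h + p]addrC distrC.
near=> h.
have E0 : dray_mean h = (ray_mean k F (h + p) - ray_mean k F p) -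
   (ray_mean k F (h + p) - ray_mean k F p - dray_mean h) by rewrite opprB addrC subrK.
rewrite -[leLHS]/(`|dray_mean h|) E0 [leRHS]splitr.
rewrite (le_trans (ler_normB _ _))// lerD//; first by near: h.
rewrite (le_trans (near U1 h _))// mul1r; near: h; exact: nbhs0_le.
Unshelve. all: by end_near.
Qed.

Lemma ray_mean_expansion :
  ray_mean k F \o shift p = cst (ray_mean k F p) + dray_mean +o_ (0 : V) id.
Proof.
apply/eqaddoP => eps eps0; have U := ray_mean_remainder eps0.
near=> h; have H := near U h; rewrite /= opprD.
rewrite -![(_ + _ : _ -> _) _]/(_ + _) -![(- _ : _ -> _) _]/(- _) addrA.
exact: H.
Unshelve. all: by end_near.
Qed.

Lemma ray_mean_diff : 'd (ray_mean k F) p = dray_mean :> (V -> R).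
Proof. exact: (diff_unique dray_mean_continuous ray_mean_expansion). Qed.

Lemma differentiable_ray_mean : differentiable (ray_mean k F) p.
Proof.
apply/diff_locallyP; rewrite ray_mean_diff; split; first exact: dray_mean_continuous.
exact: ray_mean_expansion.
Qed.

Lemma derive_ray_mean h : 'D_h (ray_mean k F) p =
  ray_mean k ('D_(A h) F) p + ray_mean k.+1 ('D_(B h) F) p.
Proof. by rewrite deriveE ?ray_mean_diff//; exact: differentiable_ray_mean. Qed.

End DifferentiateRayMean.

(** Each derivative of a ray mean of F is a sum of two ray means of
    derivatives of F. *)
Lemma class_C_ray_mean m k (F : E -> R) : class_C m F -> class_C m (ray_mean k F).
Proof.
elim: m k F => [|m IH] k F CF; first exact: ray_mean_continuous.
have [dF DF] := CF.
have cDF v : continuous ('D_v F) by exact: class_C_continuous (DF v).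
split=> [p|v]; first exact: differentiable_ray_mean.
rewrite (_ : (fun p => 'D_v _ p) =
  (fun p => ray_mean k ('D_(A v) F) p + ray_mean k.+1 ('D_(B v) F) p)).
  exact: class_C_add (IH k _ (DF (A v))) (IH k.+1 _ (DF (B v))).
by apply/funext => p; exact: derive_ray_mean.
Qed.

Lemma smooth_ray_mean k (F : E -> R) : smooth F -> smooth (ray_mean k F).
Proof. by move=> sF m; exact: class_C_ray_mean. Qed.

Lemma derive_smooth_ray_mean k (F : E -> R) p v : smooth F ->
  'D_v (ray_mean k F) p =
  ray_mean k ('D_(A v) F) p + ray_mean k.+1 ('D_(B v) F) p.
Proof.
move=> sF; apply: derive_ray_mean => [q|u]; first exact: smooth_differentiable.
exact/smooth_continuous/smooth_derive.
Qed.

End RayMean.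

Section RayMeanExtra.
Context {R : realType} {V E : normedModType R}.
Variables (A B : {linear V -> E}).
Hypotheses (cA : continuous A) (cB : continuous B).

Lemma mean_cst (a : R) : mean (fun=> a) = a.
Proof.
have d (s : R) : is_derive s 1 (fun s => s * a) a.
  apply: (is_derive_eq (is_deriveM (is_derive_id s 1) (is_derive_cst a s 1))).
  by rewrite scaler0 add0r; exact: mulr1.
by rewrite (mean_derive _ d) ?mul1r ?mul0r ?subr0// => s; exact: cst_continuous.
Qed.

Lemma ray_mean_zero k p : ray_mean A B k (fun=> 0) p = 0.
Proof.
rewrite /ray_mean -[RHS]mean_cst; apply: eq_mean => s; exact: mulr0.
Qed.

Lemma ray_mean_sum k (I : finType) (a : I -> R) (F : I -> E -> R) p :
  (forall i, continuous (F i)) ->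
  ray_mean A B k (fun q => \sum_i a i * F i q) p = \sum_i a i * ray_mean A B k (F i) p.
Proof.
move=> cF; rewrite /index_enum.
suff [] : continuous (fun q => \sum_(i <- Finite.enum I) a i * F i q) /\
  ray_mean A B k (fun q => \sum_(i <- Finite.enum I) a i * F i q) p =
  \sum_(i <- Finite.enum I) a i * ray_mean A B k (F i) p by [].
elim: (Finite.enum I) => [|i r [cr IH]].
  have -> : (fun q => \sum_(i <- [::]) a i * F i q) = fun=> 0.
    by apply/funext => q; rewrite big_nil.
  by rewrite big_nil ray_mean_zero; split=> //; exact: cst_continuous.
have ci : continuous (fun q => a i * F i q).
  by move=> q; apply: cvgM; [exact: cvg_cst|exact: cF].
have -> : (fun q => \sum_(j <- i :: r) a j * F j q) =
          (fun q => a i * F i q + \sum_(j <- r) a j * F j q).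
  by apply/funext => q; rewrite big_cons.
rewrite big_cons ray_meanD// IH ray_meanZ//; split=> // q.
exact: (cvgD (ci q) (cr q)).
Qed.

End RayMeanExtra.

Section Homotopy.
Context {R : realType} {V E : normedModType R}.
Variables (A B : {linear V -> E}).
Hypotheses (cA : continuous A) (cB : continuous B).

Lemma is_derive_ray (F : E -> R) p (s : R) : smooth F ->
  is_derive s 1 (fun s => F (ray A B s p)) ('D_(B p) F (ray A B s p)).
Proof.
move=> sF; rewrite /ray; under eq_fun do rewrite addrC.
by rewrite addrC; apply: is_derive_affine; exact: smooth_differentiable.
Qed.

Lemma ray_mean_derive (F : E -> R) p : smooth F ->
  ray_mean A B 0 ('D_(B p) F) p = F (A p + B p) - F (A p).
Proof.
move=> sF; rewrite /ray_mean.
have d (s : R) : is_derive s 1 (fun s => F (ray A B s p))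
    (s ^+ 0 * 'D_(B p) F (ray A B s p)).
  by rewrite expr0 mul1r; exact: is_derive_ray.
rewrite (mean_derive _ d); first by rewrite /ray scale1r scale0r addr0.
exact: (ray_integrand_continuous cA cB (k := 0) (p := p)
          (smooth_continuous (smooth_derive (B p) sF))).
Qed.

(** Together, the two integrands are the derivative in s of
    s * F (ray A B s p). When A + B is the identity this recovers F from its
    derivatives, as in the homotopy formula behind the Poincare lemma. *)
Lemma ray_mean_homotopy (F : E -> R) p : smooth F ->
  ray_mean A B 0 F p + ray_mean A B 1 ('D_(B p) F) p = F (A p + B p).
Proof.
move=> sF.
have c0 := ray_integrand_continuous cA cB (k := 0) (p := p) (smooth_continuous sF).
have c1 := ray_integrand_continuous cA cB (k := 1) (p := p)
  (smooth_continuous (smooth_derive (B p) sF)).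
rewrite /ray_mean -meanD//.
have d (s : R) : is_derive s 1 (fun s => s * F (ray A B s p))
    (s ^+ 0 * F (ray A B s p) + s ^+ 1 * 'D_(B p) F (ray A B s p)).
  apply: (is_derive_eq (is_deriveM (is_derive_id s 1) (is_derive_ray p s sF))).
  by rewrite expr0 mul1r expr1 addrC; congr (_ + _); exact: mulr1.
rewrite (mean_derive _ d); first by rewrite /ray scale1r mul1r mul0r subr0.
by move=> s; exact: (cvgD (c0 s) (c1 s)).
Qed.

End Homotopy.

(** * Symmetry of second derivatives *)
Section Schwarz.
Context {R : realType} {E : normedModType R}.
Variables (I : finType) (e : I -> E) (c : I -> E -> R).
Hypothesis ec : forall h, h = \sum_i c i h *: e i.
Hypothesis c_le : forall i h, `|c i h| <= `|h|.

(** The increment F (t *: v + x) - F x equals t times the mean of 'D_v F over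
    the segment, and that mean is smooth in (x, t). Differentiating the
    identity along u, under the integral sign, and then in t at t = 0 gives
    'D_v ('D_u F) on the left and 'D_u ('D_v F) on the right. *)
Lemma derive_comm (F : E -> R) (u v p : E) : smooth F ->
  'D_v ('D_u F) p = 'D_u ('D_v F) p.
Proof.
move=> sF.
pose A : {linear (E * R)%type -> E} := fst.
pose S : {linear (E * R)%type -> R} := snd.
have linB : linear (fun q : E * R => q.2 *: v).
  by move=> a x y; rewrite /= scalerDl scalerA.
pose B : {linear (E * R)%type -> E} :=
  HB.pack (fun q : E * R => q.2 *: v) (GRing.isLinear.Build R (E * R)%type E _ _ linB).
have cA : continuous A by move=> q; exact: cvg_fst.
have cB : continuous B by move=> q; apply: cvgZr_tmp; exact: cvg_snd.
have sS : smooth S by apply: smooth_linear => q; exact: cvg_snd.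
have sDF : smooth ('D_v F) by exact: smooth_derive.
pose K := ray_mean A B 0 ('D_v F); pose J := ray_mean A B 0 ('D_u ('D_v F)).
have sK : smooth K by exact: (smooth_ray_mean cA cB ec c_le).
have sJ : smooth J by apply: (smooth_ray_mean cA cB ec c_le); exact: smooth_derive.
have taylor x t : F (t *: v + x) = F x + t * K (x, t).
  rewrite -[LHS](subrK (F x)) [LHS]addrC; congr (_ + _).
  have := ray_mean_derive cA cB (x, t) sF; rewrite /= [x + _]addrC => <-.
  rewrite /K -(ray_meanZ cA cB)//; last exact: smooth_continuous.
  congr (ray_mean _ _ _ _ _); apply/funext => q.
  by rewrite derive_dirZ//; exact: smooth_differentiable.
have DK t : 'D_(u, 0) K (p, t) = J (p, t).
  rewrite /K (derive_smooth_ray_mean cA cB ec c_le)//.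
  have D0 : ray_mean A B 1 ('D_(B (u, 0)) ('D_v F)) (p, t) = 0.
    rewrite -[RHS](ray_mean_zero A B 1 (p, t)); congr (ray_mean _ _ _ _ _).
    apply/funext => q; rewrite -[RHS](derive0 ('D_v F) q); congr (derive _ _ _).
    exact: scale0r.
  by rewrite D0 addr0.
have cst_smooth (a : R) : smooth (fun _ : E * R => a) by move=> k; exact: class_C_cst.
have increment t : 'D_u F (t *: v + p) = 'D_u F p + t * J (p, t).
  have sFA : smooth (F \o A) by move=> k; exact: class_C_comp_linear.
  rewrite (@derive_line _ _ _ _ F (fun q => (F \o A) q + t * K q) _ (p, t) _ (u, 0)).
    rewrite derive_smooth_add//; last exact: smooth_mul.
    rewrite derive_smooth_mul// derive_cst mul0r addr0 DK; congr (_ + _).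
  move=> h; rewrite addrCA taylor; congr (_ + _ * K _).
  have -> : h *: (u, 0 : R) + (p, t) = (h *: u + p, h *: (0 : R) + t) by [].
  by rewrite scaler0 add0r.
rewrite (@derive_line _ _ _ _ _ (fun q : E * R => 'D_u F p + S q * J q)
  _ (p, 0) _ (0, 1)).
  rewrite derive_smooth_add//; last exact: smooth_mul.
  rewrite derive_smooth_mul// derive_cst add0r mul0r add0r.
  rewrite derive_linear; last by move=> q; exact: cvg_snd.
  rewrite mul1r /J /ray_mean -[RHS]mean_cst; apply: eq_mean => s.
  by rewrite expr0 mul1r /ray /= scale0r scaler0 addr0.
move=> h; rewrite increment.
have -> : h *: (0, 1) + (p, 0) = (h *: (0 : E) + p, h * 1 + 0) :> E * R by [].
by rewrite scaler0 add0r mulr1 addr0.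
Qed.

End Schwarz.

(** * The space of first-order jets *)
Section Frame.
Context {R : realType} {E W : normedModType R}.
Variables (I : finType) (e : I -> E) (c : I -> E -> R).
Hypothesis ec : forall h, h = \sum_i c i h *: e i.
Hypothesis c_le : forall i h, `|c i h| <= `|h|.

Lemma frame_linear_continuous (f : {linear E -> W}) : continuous f.
Proof.
apply: bounded_linear_continuous; apply/linear_boundedP.
near=> r => h; apply: (@le_trans _ _ ((\sum_i `|f (e i)|) * `|h|)).
  rewrite {1}(ec h) linear_sum mulr_suml (le_trans (ler_norm_sum _ _ _))//.
  by apply: ler_sum => i _; rewrite linearZ normrZ mulrC ler_wpM2l.
by rewrite ler_wpM2r//; near: r; apply: nbhs_pinfty_ge; exact: num_real.
Unshelve. all: by end_near.
Qed.

End Frame.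

(** Triples (t, x, x'), with the position and the velocity as the two columns
    of the matrix, as in jet 1. *)
Definition jet_space (R : realType) (n : nat) : normedModType R :=
  (R * 'M[R]_(n, 2))%type.

HB.lock Definition xdir (R : realType) (n : nat) (i : 'I_n) : jet_space R n :=
  (0, delta_mx i ord0).

HB.lock Definition vdir (R : realType) (n : nat) (i : 'I_n) : jet_space R n :=
  (0, delta_mx i ord_max).

Arguments xdir {R n} i.
Arguments vdir {R n} i.

Section JetSpace.
Context {R : realType} {n : nat}.
Notation E := (jet_space R n).

Definition frame_index : finType := ('I_1 + 'I_n * 'I_2)%type.

Definition frame_vector (i : frame_index) : E :=
  match i with inl _ => (1, 0) | inr kl => (0, delta_mx kl.1 kl.2) end.

Definition frame_coord (i : frame_index) (p : E) : R :=
  match i with inl _ => p.1 | inr kl => p.2 kl.1 kl.2 end.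

Lemma frame_expansion p : p = \sum_i frame_coord i p *: frame_vector i.
Proof.
rewrite big_sumType big_ord1 /=.
rewrite -(pair_bigA _ (fun k l => p.2 k l *: ((0, delta_mx k l) : E))) /=.
apply: injective_projections; rewrite /= raddf_sum /=.
  rewrite big1 ?addr0; first exact/esym/mulr1.
  by move=> k _; rewrite raddf_sum big1// => l _; exact: mulr0.
rewrite scaler0 add0r [LHS]matrix_sum_delta; apply: eq_bigr => k _.
by rewrite raddf_sum.
Qed.

Lemma frame_coord_le i p : `|frame_coord i p| <= `|p|.
Proof.
rewrite prod_normE; case: i => [i|kl] /=; first by rewrite le_max lexx.
rewrite le_max; apply/orP; right.
rewrite [leRHS]/Num.norm /= mx_normrE; apply/bigmax_geP; right.
by exists kl.
Qed.

Definition xcoord (i : 'I_n) (p : E) : R := p.2 i ord0.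
Definition vcoord (i : 'I_n) (p : E) : R := p.2 i ord_max.

Definition scale_jet (a b c : R) (p : E) : E :=
  (a * p.1, \matrix_(i, l) ((if l == ord0 then b else c) * p.2 i l)).

Lemma scale_jet_linear a b c : linear (scale_jet a b c).
Proof.
move=> r p q; congr pair; first by rewrite /= mulrDr mulrCA.
by apply/matrixP => i l; rewrite !mxE mulrDr mulrCA.
Qed.

HB.instance Definition _ a b c :=
  GRing.isLinear.Build R E E _ (scale_jet a b c) (@scale_jet_linear a b c).

Lemma xcoord_linear i : linear (xcoord i).
Proof. by move=> r p q; rewrite /xcoord !mxE. Qed.
HB.instance Definition _ i :=
  GRing.isLinear.Build R E R _ (xcoord i) (@xcoord_linear i).

Lemma vcoord_linear i : linear (vcoord i).
Proof. by move=> r p q; rewrite /vcoord !mxE. Qed.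
HB.instance Definition _ i :=
  GRing.isLinear.Build R E R _ (vcoord i) (@vcoord_linear i).

Lemma jet_linear_continuous (W : normedModType R) (f : {linear E -> W}) : continuous f.
Proof. exact: frame_linear_continuous frame_expansion frame_coord_le f. Qed.

Lemma scale_jet_xdir a b c i : scale_jet a b c (xdir i) = b *: xdir i.
Proof.
rewrite xdir.unlock; congr pair; first by rewrite /= mulr0; exact/esym/mulr0.
by apply/matrixP => k l; rewrite !mxE; case: (eqVneq l ord0); rewrite ?andbF ?mulr0.
Qed.

Lemma scale_jet_vdir a b c i : scale_jet a b c (vdir i) = c *: vdir i.
Proof.
rewrite vdir.unlock; congr pair; first by rewrite /= mulr0; exact/esym/mulr0.
apply/matrixP => k l; rewrite !mxE.
by case: (eqVneq l ord0) => [->|_] //; rewrite andbF !mulr0.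
Qed.

Lemma jet_expansion p : p = p.1 *: ((1, 0) : E) +
  (\sum_i xcoord i p *: xdir i + \sum_i vcoord i p *: vdir i).
Proof.
rewrite xdir.unlock vdir.unlock [LHS]frame_expansion big_sumType big_ord1 /=.
rewrite -(pair_bigA _ (fun k l => p.2 k l *: ((0, delta_mx k l) : E))) /=.
rewrite -big_split; congr (_ + _); apply: eq_bigr => i _ /=.
by rewrite big_ord_recl big_ord1 (_ : lift _ _ = ord_max)//; exact: val_inj.
Qed.

Lemma scale_jet0E b c p : scale_jet 0 b c p =
  \sum_i (b * xcoord i p) *: xdir i + \sum_i (c * vcoord i p) *: vdir i.
Proof.
rewrite [LHS]jet_expansion /= mul0r scale0r add0r.
by congr (_ + _); apply: eq_bigr => i _; rewrite /xcoord /vcoord mxE.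
Qed.

Lemma scale_jetD a b c a' b' c' p :
  scale_jet a b c p + scale_jet a' b' c' p = scale_jet (a + a') (b + b') (c + c') p.
Proof.
congr pair; first by rewrite /= mulrDl.
by apply/matrixP => i l; rewrite !mxE; case: eqP => _; rewrite mulrDl.
Qed.

Lemma scale_jetZ s a b c p : s *: scale_jet a b c p = scale_jet (s * a) (s * b) (s * c) p.
Proof.
congr pair; first by rewrite /= -mulrA.
by apply/matrixP => i l; rewrite !mxE; case: eqP => _; rewrite -mulrA.
Qed.

Lemma scale_jet1 p : scale_jet 1 1 1 p = p.
Proof.
case: p => t w; congr pair; first exact: mul1r.
by apply/matrixP => i l; rewrite !mxE if_same mul1r.
Qed.

End JetSpace.

(** * Means over velocities and over dilations *)
Section JetMeans.
Context {R : realType} {n : nat}.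
Notation E := (jet_space R n).
Implicit Types (F G : E -> R) (p q h : E) (k : nat) (i j : 'I_n).

(** The ray through (t, x, v) is s |-> (t, x, s v). *)
Definition fiber_mean : nat -> (E -> R) -> E -> R :=
  ray_mean (scale_jet 1 1 0) (scale_jet 0 0 1).

(** The ray through (t, x, v) is s |-> (t, s x, s v). *)
Definition dilation_mean : nat -> (E -> R) -> E -> R :=
  ray_mean (scale_jet 1 0 0) (scale_jet 0 1 1).

Lemma eq_fiber_mean k F G p : F =1 G -> fiber_mean k F p = fiber_mean k G p.
Proof. by move=> /funext ->. Qed.

Lemma eq_dilation_mean k F G p : F =1 G -> dilation_mean k F p = dilation_mean k G p.
Proof. by move=> /funext ->. Qed.

Lemma dilation_meanB k F G p : smooth F -> smooth G ->
  dilation_mean k (fun q => F q - G q) p = dilation_mean k F p - dilation_mean k G p.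
Proof.
move=> /smooth_continuous cF /smooth_continuous cG.
have [cA cB] : continuous (scale_jet 1 0 0 : E -> E) /\
    continuous (scale_jet 0 1 1 : E -> E).
  by split; exact: jet_linear_continuous.
have ci H := @ray_integrand_continuous _ _ _ _ _ cA cB k H p.
rewrite /dilation_mean /ray_mean -(meanB (ci F cF) (ci G cG)).
by apply: eq_mean => s; rewrite mulrBr.
Qed.

Lemma dilation_meanN k F p : smooth F ->
  dilation_mean k (fun q => - F q) p = - dilation_mean k F p.
Proof.
move=> /smooth_continuous cF.
have [cA cB] : continuous (scale_jet 1 0 0 : E -> E) /\
    continuous (scale_jet 0 1 1 : E -> E).
  by split; exact: jet_linear_continuous.
rewrite -mulN1r -(ray_meanZ cA cB)//.
by apply: eq_dilation_mean => q; rewrite mulN1r.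
Qed.

Lemma smooth_jet_ray_mean (A B : {linear E -> E}) k F :
  smooth F -> smooth (ray_mean A B k F).
Proof.
have [cA cB] : continuous A /\ continuous B by split; exact: jet_linear_continuous.
exact: (smooth_ray_mean cA cB frame_expansion frame_coord_le).
Qed.

Lemma smooth_fiber_mean k F : smooth F -> smooth (fiber_mean k F).
Proof.
exact: smooth_jet_ray_mean.
Qed.

Lemma smooth_dilation_mean k F : smooth F -> smooth (dilation_mean k F).
Proof.
exact: smooth_jet_ray_mean.
Qed.

Lemma derive_ray_mean_eigen (A B : {linear E -> E}) (a b : R) k F p h :
  A h = a *: h -> B h = b *: h -> smooth F ->
  'D_h (ray_mean A B k F) p =
  a * ray_mean A B k ('D_h F) p + b * ray_mean A B k.+1 ('D_h F) p.
Proof.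
move=> Ah Bh sF.
have [cA cB] : continuous A /\ continuous B by split; exact: jet_linear_continuous.
have sDF := smooth_continuous (smooth_derive h sF).
rewrite (derive_smooth_ray_mean cA cB frame_expansion frame_coord_le)//.
rewrite Ah Bh -!ray_meanZ//; congr (_ + _); congr (ray_mean _ _ _ _ _).
all: by apply/funext => q; rewrite derive_dirZ//; exact: smooth_differentiable.
Qed.

Lemma derive_vdir_fiber_mean k F p i : smooth F ->
  'D_(vdir i) (fiber_mean k F) p = fiber_mean k.+1 ('D_(vdir i) F) p.
Proof.
move=> sF.
rewrite (derive_ray_mean_eigen _ _ (scale_jet_vdir _ _ _ _) (scale_jet_vdir _ _ _ _))//.
by rewrite mul1r mul0r add0r.
Qed.

Lemma derive_xdir_dilation_mean k F p i : smooth F ->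
  'D_(xdir i) (dilation_mean k F) p = dilation_mean k.+1 ('D_(xdir i) F) p.
Proof.
move=> sF.
rewrite (derive_ray_mean_eigen _ _ (scale_jet_xdir _ _ _ _) (scale_jet_xdir _ _ _ _))//.
by rewrite mul1r mul0r add0r.
Qed.

Lemma derive_vdir_dilation_mean k F p i : smooth F ->
  'D_(vdir i) (dilation_mean k F) p = dilation_mean k.+1 ('D_(vdir i) F) p.
Proof.
move=> sF.
rewrite (derive_ray_mean_eigen _ _ (scale_jet_vdir _ _ _ _) (scale_jet_vdir _ _ _ _))//.
by rewrite mul1r mul0r add0r.
Qed.

Lemma ray_mean_euler (A B : {linear E -> E}) (I : finType) (a : I -> R) (e : I -> E) F p :
  smooth F -> A p + B p = p -> B p = \sum_i a i *: e i ->
  ray_mean A B 0 F p + \sum_i a i * ray_mean A B 1 ('D_(e i) F) p = F p.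
Proof.
move=> sF ABp Bp.
have [cA cB] : continuous A /\ continuous B by split; exact: jet_linear_continuous.
have sD h : smooth ('D_h F) by exact: smooth_derive.
have DBp : 'D_(B p) F = (fun q => \sum_i a i * 'D_(e i) F q).
  apply/funext => q; have dF : differentiable F q by exact: smooth_differentiable.
  by rewrite Bp !derive_dir_sum.
rewrite -[RHS](congr1 F ABp) -(ray_mean_homotopy cA cB p sF); congr (_ + _).
rewrite [RHS](congr1 (fun G => ray_mean A B 1 G p) DBp).
by rewrite (ray_mean_sum cA cB)// => i; exact: smooth_continuous.
Qed.

Lemma derive_coord_sum (kappa : 'I_n -> {linear E -> R}) (G : 'I_n -> E -> R) h p :
  (forall j, smooth (G j)) ->
  'D_h (fun q => \sum_j kappa j q * G j q) p =
  \sum_j kappa j p * 'D_h (G j) p + \sum_j kappa j h * G j p.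
Proof.
move=> sG.
have sk j : smooth (kappa j) by exact/smooth_linear/jet_linear_continuous.
rewrite derive_smooth_sum; last by move=> j; exact: smooth_mul.
rewrite -big_split; apply: eq_bigr => j _ /=.
by rewrite derive_smooth_mul// derive_linear//; exact: jet_linear_continuous.
Qed.

Lemma smooth_coord_sum (kappa : 'I_n -> {linear E -> R}) (G : 'I_n -> E -> R) :
  (forall j, smooth (G j)) -> smooth (fun q => \sum_j kappa j q * G j q).
Proof.
move=> sG; apply: smooth_sum => j; apply: smooth_mul => //.
exact/smooth_linear/jet_linear_continuous.
Qed.

Lemma vcoord_xdir i j : vcoord i (xdir j) = 0 :> R.
Proof. by rewrite /vcoord xdir.unlock mxE andbF. Qed.

Lemma xcoord_vdir i j : xcoord i (vdir j) = 0 :> R.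
Proof. by rewrite /xcoord vdir.unlock mxE andbF. Qed.

Lemma xcoord_xdir i j : xcoord i (xdir j) = (i == j)%:R :> R.
Proof. by rewrite /xcoord xdir.unlock mxE eqxx andbT. Qed.

Lemma vcoord_vdir i j : vcoord i (vdir j) = (i == j)%:R :> R.
Proof. by rewrite /vcoord vdir.unlock mxE eqxx andbT. Qed.

Lemma fiber_mean_euler F p : smooth F ->
  fiber_mean 0 F p + \sum_i vcoord i p * fiber_mean 1 ('D_(vdir i) F) p = F p.
Proof.
move=> sF; apply: ray_mean_euler => //.
  by rewrite scale_jetD !addr0 !add0r scale_jet1.
rewrite -[LHS]/(scale_jet 0 0 1 p) scale_jet0E big1 ?add0r; last first.
  by move=> i _; rewrite mul0r scale0r.
by apply: eq_bigr => i _; rewrite mul1r.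
Qed.

Lemma dilation_mean_euler F p : smooth F ->
  dilation_mean 0 F p +
    (\sum_i xcoord i p * dilation_mean 1 ('D_(xdir i) F) p +
     \sum_i vcoord i p * dilation_mean 1 ('D_(vdir i) F) p) = F p.
Proof.
move=> sF.
have := @ray_mean_euler (scale_jet 1 0 0) (scale_jet 0 1 1) ('I_n + 'I_n)%type
  (fun i : ('I_n + 'I_n)%type =>
    match i with inl i => xcoord i p | inr i => vcoord i p end)
  (fun i : ('I_n + 'I_n)%type =>
    match i with inl i => xdir i | inr i => vdir i end) F p sF.
rewrite scale_jetD !addr0 !add0r scale_jet1 !big_sumType; apply=> //.
rewrite -[LHS]/(scale_jet 0 1 1 p) scale_jet0E.
by congr (_ + _); apply: eq_bigr => i _; rewrite mul1r.
Qed.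

(** The vectors tangent at p to prolonged curves t |-> (t, x, x'). The total
    derivative at p is the derivative along such a vector, the acceleration
    being its velocity component. *)
Definition contact p h := h.1 = 1 /\ forall i, xcoord i h = vcoord i p.

Lemma dilation_rayE (s : R) p :
  ray (scale_jet 1 0 0) (scale_jet 0 1 1) s p = scale_jet 1 s s p.
Proof. by rewrite /ray scale_jetZ scale_jetD mulr0 mulr1 addr0 !add0r. Qed.

(** Dilations act on curves, x |-> s x, hence preserve contact vectors. *)
Lemma contact_scale_jet (s : R) p h : contact p h ->
  contact (scale_jet 1 s s p) (scale_jet 1 s s h).
Proof.
move=> [h1 hx]; split=> [|i]; first by rewrite /= mul1r.
by rewrite /xcoord /vcoord !mxE /= -[h.2 i ord0]/(xcoord i h) hx.
Qed.

(** Total derivatives may be taken under the dilation mean, since the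
    vector h at p induces on the whole ray vectors that are again of contact
    type, to which the hypothesis applies. *)
Lemma derive_contact_dilation_mean F G p h : smooth F -> contact p h ->
  (forall q v, contact q v -> 'D_v F q = G q) ->
  'D_h (dilation_mean 1 F) p = dilation_mean 1 G p.
Proof.
move=> sF ph FG.
have [cA cB] : continuous (scale_jet 1 0 0 : E -> E) /\
    continuous (scale_jet 0 1 1 : E -> E).
  by split; exact: jet_linear_continuous.
rewrite (derive_smooth_ray_mean cA cB frame_expansion frame_coord_le)//.
transitivity (dray_mean (scale_jet 1 0 0) (scale_jet 0 1 1) 1 F p h); first by [].
rewrite dray_meanE//.
- by apply: eq_mean => s; rewrite !dilation_rayE (FG _ _ (contact_scale_jet s ph)).
- by move=> q; exact: smooth_differentiable.
- by move=> v; exact/smooth_continuous/smooth_derive.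
Qed.

End JetMeans.

(** * Solution of the inverse problem *)
Section Kinetic.
Context {R : realType} {n : nat}.
Notation E := (jet_space R n).
Variable P : 'I_n -> E -> R.
Hypothesis sP : forall i, smooth (P i).
Hypothesis symP : forall i j, 'D_(vdir j) (P i) =1 'D_(vdir i) (P j).

(** On each fibre of velocities the 1-form sum_i P_i dv_i is closed, and the
    fibre is star-shaped: K (t, x, v) is the integral over s in [0, 1] of
    sum_j v_j P_j (t, x, s v). Differentiation in v_i and the symmetry turn
    the integrand into the derivative of s P_i (t, x, s v). *)
Lemma momentum_potential :
  exists2 K : E -> R, smooth K & forall i, 'D_(vdir i) K =1 P i.
Proof.
have sF j : smooth (fiber_mean 0 (P j)) by exact: smooth_fiber_mean.
exists (fun p => \sum_j vcoord j p * fiber_mean 0 (P j) p) => [|i p].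
  exact: smooth_coord_sum.
rewrite derive_coord_sum//; apply: etrans (fiber_mean_euler p (sP i)).
rewrite addrC; congr (_ + _).
  rewrite (bigD1 i)//= vcoord_vdir eqxx mul1r big1 ?addr0// => j ji.
  by rewrite vcoord_vdir (negPf ji) mul0r.
apply: eq_bigr => j _; rewrite derive_vdir_fiber_mean//.
by rewrite (eq_fiber_mean 1 p (symP j i)).
Qed.

End Kinetic.

Section Potential.
Context {R : realType} {n : nat}.
Notation E := (jet_space R n).
Variable g : 'I_n -> E -> R.
Hypothesis sg : forall i, smooth (g i).
Hypothesis antig : forall i j p, 'D_(vdir j) (g i) p = - 'D_(vdir i) (g j) p.
Hypothesis closedg : forall i j p h, contact p h ->
  'D_h ('D_(vdir j) (g i)) p = 'D_(xdir j) (g i) p - 'D_(xdir i) (g j) p.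

(** The hypotheses are the Helmholtz conditions of the first-order system
    g = 0. The potential is Volterra's one: U (t, x, v) is the integral over
    s in [0, 1] of sum_j x_j g_j (t, s x, s v). Its Euler-Lagrange
    expression contains the adjoint of the linearization of g, and the
    conditions say that the linearization is self-adjoint, so the integrand
    becomes the derivative of s g_i (t, s x, s v). *)
Lemma first_order_potential : exists2 U : E -> R, smooth U &
  forall i p h, contact p h ->
    'D_(xdir i) U p - 'D_h ('D_(vdir i) U) p = g i p.
Proof.
have sd k : smooth (dilation_mean 0 (g k)) by exact: smooth_dilation_mean.
pose U (p : E) := \sum_j xcoord j p * dilation_mean 0 (g j) p.
exists U => [|i p h ph]; first exact: smooth_coord_sum.
have DxU : 'D_(xdir i) U p =
    \sum_j xcoord j p * dilation_mean 1 ('D_(xdir i) (g j)) p + dilation_mean 0 (g i) p.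
  rewrite derive_coord_sum//; congr (_ + _).
    by apply: eq_bigr => j _; rewrite derive_xdir_dilation_mean.
  rewrite (bigD1 i)//= xcoord_xdir eqxx mul1r big1 ?addr0// => j ji.
  by rewrite xcoord_xdir (negPf ji) mul0r.
have DvU : 'D_(vdir i) U =
    (fun q => \sum_j xcoord j q * dilation_mean 1 ('D_(vdir i) (g j)) q).
  apply/funext => q; rewrite derive_coord_sum// [X in _ + X]big1 ?addr0.
    by apply: eq_bigr => j _; rewrite derive_vdir_dilation_mean.
  by move=> j _; rewrite /= xcoord_vdir mul0r.
have DhM j : 'D_h (dilation_mean 1 ('D_(vdir i) (g j))) p =
    dilation_mean 1 ('D_(xdir i) (g j)) p - dilation_mean 1 ('D_(xdir j) (g i)) p.
  apply: etrans (dilation_meanB 1 p _ _); try exact: smooth_derive.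
  apply: derive_contact_dilation_mean => //; first exact: smooth_derive.
  by move=> q v qv; exact: closedg.
have vM j : dilation_mean 1 ('D_(vdir i) (g j)) p =
    - dilation_mean 1 ('D_(vdir j) (g i)) p.
  apply: etrans (dilation_meanN 1 p _); last exact: smooth_derive.
  by apply: eq_dilation_mean => q; exact: antig.
have DhDvU : 'D_h ('D_(vdir i) U) p =
  (\sum_j xcoord j p * dilation_mean 1 ('D_(xdir i) (g j)) p -
   \sum_j xcoord j p * dilation_mean 1 ('D_(xdir j) (g i)) p) -
  \sum_j vcoord j p * dilation_mean 1 ('D_(vdir j) (g i)) p.
  rewrite DvU derive_coord_sum; last first.
    by move=> j; apply: smooth_dilation_mean; exact: smooth_derive.
  congr (_ + _).
    by rewrite -sumrB; apply: eq_bigr => j _; rewrite DhM mulrBr.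
  rewrite -sumrN; apply: eq_bigr => j _; case: ph => _ /(_ j) /= ->.
  by rewrite vM mulrN.
rewrite DxU DhDvU; apply: etrans (dilation_mean_euler p (sg i)).
have cancel (a b c d : R) : a + b - (a - c - d) = b + (c + d) by ring.
exact: cancel.
Qed.

End Potential.

Section InverseProblem.
Context {R : realType} {n : nat}.
Notation E := (jet_space R n).
Variables (P f : 'I_n -> E -> R).
Hypotheses (sP : forall i, smooth (P i)) (sf : forall i, smooth (f i)).

Hypothesis H1 : forall i j, 'D_(vdir j) (P i) =1 'D_(vdir i) (P j).
Hypothesis H2 : forall i j p, 'D_(xdir j) (P i) p + 'D_(xdir i) (P j) p =
  'D_(vdir j) (f i) p + 'D_(vdir i) (f j) p.
Hypothesis H3 : forall i j p h, contact p h ->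
  'D_h ('D_(xdir j) (P i)) p =
  'D_(xdir j) (f i) p - 'D_(xdir i) (f j) p + 'D_h ('D_(vdir i) (f j)) p.

(** With K the potential of the momenta P, the Euler-Lagrange expression of K
    is 'D_(xdir i) K - 'D_h (P i), so what remains to be produced is
    g_i = f_i - 'D_(xdir i) K, where no acceleration occurs. For these g the
    last two hypotheses become those of first_order_potential, because
    second derivatives of K commute and 'D_(vdir j) K = P j. *)
Theorem helmholtz_lagrangian : exists2 L : E -> R, smooth L &
  forall i p h, contact p h ->
    'D_(xdir i) L p - 'D_h ('D_(vdir i) L) p = - ('D_h (P i) p - f i p).
Proof.
have [K sK DvK] := momentum_potential sP H1.
pose g i (p : E) := f i p - 'D_(xdir i) K p.
have sDK h : smooth ('D_h K) by exact: smooth_derive.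
have sg i : smooth (g i) by exact: smooth_sub.
have xg i j p : 'D_(xdir j) (g i) p = 'D_(xdir j) (f i) p - 'D_(xdir j) ('D_(xdir i) K) p.
  exact: derive_smooth_sub.
have vg i j p : 'D_(vdir j) (g i) p = 'D_(vdir j) (f i) p - 'D_(xdir i) (P j) p.
  apply: etrans (derive_smooth_sub _ _ _ _) _ => //; congr (_ - _).
  rewrite (derive_comm frame_expansion frame_coord_le _ _ _ sK).
  by rewrite (funext (DvK j)).
have antig i j p : 'D_(vdir j) (g i) p = - 'D_(vdir i) (g j) p.
  apply: etrans (vg i j p) _; apply: etrans (esym (congr1 -%R (vg j i p))).
  have solve (a b c d : R) : a + b = c + d -> c - b = - (d - a) by lra.
  exact: solve (H2 i j p).
have closedg i j p h : contact p h ->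
    'D_h ('D_(vdir j) (g i)) p = 'D_(xdir j) (g i) p - 'D_(xdir i) (g j) p.
  move=> ph; rewrite (funext (vg i j)).
  apply: etrans (derive_smooth_sub _ _ _ _) _; try exact: smooth_derive.
  apply: etrans (congr2 (fun a b => a - b) erefl (H3 j i ph)) _.
  apply: etrans (esym (congr2 (fun a b => a - b) (xg i j p) (xg j i p))).
  have comm := derive_comm frame_expansion frame_coord_le (xdir i) (xdir j) p sK.
  have solve (a b c d d' : R) : d = d' -> a - (b - c + a) = (c - d) - (b - d').
    by move=> ->; ring.
  exact: solve comm.
have [U sU DU] := first_order_potential sg antig closedg.
exists (fun p => K p + U p) => [|i p h ph]; first exact: smooth_add.
have Dv : 'D_(vdir i) (fun q => K q + U q) = (fun q => P i q + 'D_(vdir i) U q).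
  by apply/funext => q; rewrite derive_smooth_add// DvK.
rewrite Dv derive_smooth_add// derive_smooth_add//; last exact: smooth_derive.
have solve (a b c d k : R) : b - d = k - a -> a + b - (c + d) = - (c - k) by lra.
exact: solve (DU i p h ph).
Qed.

End InverseProblem.

(** * Total derivatives and Euler-Lagrange expressions on jets *)
Section JetDictionary.
Context {R : realType} {n : nat}.
Notation E := (jet_space R n).

Definition on_jets (g : R -> 'cV[R]_n -> 'cV[R]_n -> R) (p : E) : R :=
  g p.1 (col ord0 p.2) (col ord_max p.2).

Lemma partial_velocity g j (p : E) :
  partial j (g p.1 (col ord0 p.2)) (col ord_max p.2) = 'D_(vdir j) (on_jets g) p.
Proof.
apply: derive_line => h; rewrite vdir.unlock /on_jets /=.
have -> : h *: 0 + p.1 = p.1 by rewrite scaler0 add0r.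
have -> : col ord0 (h *: delta_mx j ord_max + p.2) = col ord0 p.2.
  by apply/colP => k; rewrite !mxE andbF mulr0 add0r.
by congr (g _ _ _); apply/colP => k; rewrite !mxE eqxx andbT.
Qed.

Lemma partial_position g j (p : E) :
  partial j (fun y => g p.1 y (col ord_max p.2)) (col ord0 p.2) =
  'D_(xdir j) (on_jets g) p.
Proof.
apply: derive_line => h; rewrite xdir.unlock /on_jets /=.
have -> : h *: 0 + p.1 = p.1 by rewrite scaler0 add0r.
have -> : col ord_max (h *: delta_mx j ord0 + p.2) = col ord_max p.2.
  by apply/colP => k; rewrite !mxE andbF mulr0 add0r.
by congr (g _ _ _); apply/colP => k; rewrite !mxE eqxx andbT.
Qed.

(** By linearity of the differential, the defining sum of partial derivatives
    is a single derivative along the vector of shifted derivatives of u. *)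
Lemma total_derivativeE m (F : R -> 'M[R]_(n, m.+1) -> R) t (u : nat -> 'cV[R]_n) :
  differentiable (fun p : R * 'M[R]_(n, m.+1) => F p.1 p.2) (t, jet m u) ->
  total_derivative F t (jet m.+1 u) =
  'D_(1, jet m (fun l => u l.+1)) (fun p : R * 'M[R]_(n, m.+1) => F p.1 p.2)
    (t, jet m u).
Proof.
move=> dF; rewrite /total_derivative.
have -> : \matrix_(i < n, l < m.+1) jet m.+1 u i (widen_ord (leqnSn m.+1) l) = jet m u.
  by apply/matrixP => i l; rewrite !mxE.
set Fh := fun p : R * 'M[R]_(n, m.+1) => F p.1 p.2.
have -> : 'D_1 (F^~ (jet m u)) t = 'D_(1, 0) Fh (t, jet m u).
  by apply: derive_line => h; rewrite /Fh /= scaler0 add0r.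
have -> : ((1, jet m (fun l => u l.+1)) : R * 'M[R]_(n, m.+1)) =
   (1, 0) + \sum_(l < m.+1) \sum_(k < n)
     u l.+1 k 0 *: ((0, delta_mx k l) : R * 'M[R]_(n, m.+1)).
  apply: injective_projections; rewrite /= raddf_sum /=.
    rewrite big1 ?addr0// => l _; rewrite raddf_sum big1// => k _; exact: mulr0.
  rewrite add0r [LHS]matrix_sum_delta exchange_big; apply: eq_bigr => l _.
  by rewrite raddf_sum; apply: eq_bigr => k _; rewrite mxE.
rewrite derive_dirD//; congr (_ + _).
rewrite [RHS]deriveE// linear_sum; apply: eq_bigr => l _.
rewrite linear_sum; apply: eq_bigr => k _.
rewrite linearZ -deriveE//= !mxE; congr (_ * _).
by apply: derive_line => h; rewrite /Fh /= scaler0 add0r.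
Qed.

(** The acceleration a of ddt is the velocity component of the contact
    vector. *)
Lemma ddt_contact g (p h : E) : differentiable (on_jets g) p -> contact p h ->
  ddt g p.1 (col ord0 p.2) (col ord_max p.2) (col ord_max h.2) = 'D_h (on_jets g) p.
Proof.
move=> dg [h1 hx]; rewrite /ddt.
set u := nth _ _.
have pE : (p.1, jet 1 u) = p.
  case: p @u {dg hx} => t w; congr pair; apply/matrixP => i l.
  by rewrite !mxE; case: l => -[|[|]]//= ?; rewrite mxE; congr (w _ _); exact: val_inj.
have hE : (1, jet 1 (fun l => u l.+1)) = h.
  rewrite [RHS]surjective_pairing h1; congr pair; apply/matrixP => i l.
  rewrite !mxE; case: l => -[|[|]]//= ?; rewrite mxE.
    by rewrite -[LHS]/(vcoord i p) -hx; congr (h.2 _ _); exact: val_inj.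
  by congr (h.2 _ _); exact: val_inj.
rewrite total_derivativeE; first by rewrite pE hE.
by rewrite pE.
Qed.

Definition positions_velocities (p : E) : 'cV[R]_n * 'cV[R]_n :=
  (col ord0 p.2, col ord_max p.2).

Lemma positions_velocities_linear : linear positions_velocities.
Proof. by move=> a p q; congr pair; apply/colP => k; rewrite !mxE. Qed.
HB.instance Definition _ := GRing.isLinear.Build R E ('cV[R]_n * 'cV[R]_n)%type _
  positions_velocities positions_velocities_linear.

Definition time_positions_velocities (p : E) : R * 'cV[R]_n * 'cV[R]_n :=
  (p.1, col ord0 p.2, col ord_max p.2).

Lemma time_positions_velocities_linear : linear time_positions_velocities.
Proof. by move=> a p q; congr (_, _, _); apply/colP => k; rewrite !mxE. Qed.
HB.instance Definition _ := GRing.isLinear.Build R E (R * 'cV[R]_n * 'cV[R]_n)%type _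
  time_positions_velocities time_positions_velocities_linear.

Definition entry m (i : 'I_n) (k : 'I_m) (A : 'M[R]_(n, m)) : R := A i k.
Lemma entry_linear m i k : linear (@entry m i k).
Proof. by move=> a p q; rewrite /entry !mxE. Qed.
HB.instance Definition _ m i k := GRing.isLinear.Build R 'M[R]_(n, m) R _
  (@entry m i k) (@entry_linear m i k).

Lemma smooth_matrix_on_jets (M : 'cV[R]_n -> 'cV[R]_n -> 'M[R]_n) i k :
  smooth (fun p : 'cV[R]_n * 'cV[R]_n => M p.1 p.2) ->
  smooth (on_jets (fun _ x v => M x v i k)).
Proof.
move=> sM m.
have cE : continuous (entry i k) by exact: coord_continuous.
have cQ : continuous positions_velocities by exact: jet_linear_continuous.
exact: (class_C_linear_comp cE (class_C_comp_linear cQ (sM m))).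
Qed.

Lemma smooth_vector_on_jets (f : R -> 'cV[R]_n -> 'cV[R]_n -> 'cV[R]_n) i :
  smooth (fun p : R * 'cV[R]_n * 'cV[R]_n => f p.1.1 p.1.2 p.2) ->
  smooth (on_jets (fun t x v => f t x v i 0)).
Proof.
move=> sf m.
have cE : continuous (entry i (0 : 'I_1)) by exact: coord_continuous.
have cQ : continuous time_positions_velocities by exact: jet_linear_continuous.
exact: (class_C_linear_comp cE (class_C_comp_linear cQ (sf m))).
Qed.

Lemma prolongation_contact (t : R) (u : nat -> 'cV[R]_n) :
  contact ((t, jet 1 u) : E) (1, jet 1 (fun l => u l.+1)).
Proof. by split=> // k; rewrite /xcoord /vcoord !mxE. Qed.

Lemma euler_lagrange_first_order (L : E -> R) i t (u : nat -> 'cV[R]_n) : smooth L ->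
  euler_lagrange (fun t w => L (t, w)) i t u =
  'D_(xdir i) L (t, jet 1 u) -
  'D_((1, jet 1 (fun l => u l.+1)) : E) ('D_(vdir i) L) (t, jet 1 u).
Proof.
move=> sL; rewrite /euler_lagrange big_ord_recl big_ord1 expr0 mul1r mulN1r.
congr (_ - _).
  apply: derive_line => h; rewrite xdir.unlock /=.
  by rewrite -[in LHS](add0r t) -[in LHS](scaler0 _ h).
have pL : (fun p : R * 'M[R]_(n, 2) =>
    jet_partial i (lift ord0 ord0) (fun t w => L (t, w)) p.1 p.2) = 'D_(vdir i) L.
  apply/funext => -[s w]; apply: derive_line => h; rewrite vdir.unlock /=.
  rewrite (_ : lift ord0 ord0 = ord_max); last exact: val_inj.
  by rewrite -[in LHS](add0r s) -[in LHS](scaler0 _ h).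
apply: etrans (total_derivativeE _) _; last by rewrite pL.
by rewrite pL; apply/smooth_differentiable/smooth_derive.
Qed.

End JetDictionary.

Theorem theorem2p4 (R : realType) (n : nat)
    (M : 'cV[R]_n -> 'cV[R]_n -> 'M[R]_n)
    (f : R -> 'cV[R]_n -> 'cV[R]_n -> 'cV[R]_n)
    (M_smooth : smooth (fun p : 'cV[R]_n * 'cV[R]_n => M p.1 p.2))
    (f_smooth : smooth (fun p : R * 'cV[R]_n * 'cV[R]_n => f p.1.1 p.1.2 p.2))
    (M_sym : forall x v, (M x v)^T = M x v)
    (H1 : forall (i j : 'I_n) (x v : 'cV[R]_n),
        \sum_(k < n) partial j (fun w => M x w i k) v * v k 0
        = \sum_(k < n) partial i (fun w => M x w j k) v * v k 0)
    (H2 : forall (i j : 'I_n) (t : R) (x v : 'cV[R]_n),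
        \sum_(k < n) (partial j (fun y => M y v i k) x
                      + partial i (fun y => M y v j k) x) * v k 0
        = partial j (fun w => f t x w i 0) v
          + partial i (fun w => f t x w j 0) v)
    (H3 : forall (i j : 'I_n) (t : R) (x v a : 'cV[R]_n),
        \sum_(k < n)
          ddt (fun _ x' v' => partial j (fun y => M y v' i k) x' * v' k 0)
            t x v a
        = partial j (fun y => f t y v i 0) x
          - partial i (fun y => f t y v j 0) x
          + ddt (fun t' x' v' => partial i (fun w => f t' x' w j 0) v')
              t x v a) :
  derivable_from_variational_principle (second_order_system M f).
Proof.
pose E := jet_space R n.
pose m i k : E -> R := on_jets (fun _ x v => M x v i k).
pose F i : E -> R := on_jets (fun t x v => f t x v i 0).
pose P i (p : E) : R := \sum_k vcoord k p * m i k p.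
have sm i k : smooth (m i k) by exact: smooth_matrix_on_jets.
have sF i : smooth (F i) by exact: smooth_vector_on_jets.
have sP i : smooth (P i) by exact: smooth_coord_sum.
have DxP i j p : 'D_(xdir j) (P i) p = \sum_k vcoord k p * 'D_(xdir j) (m i k) p.
  rewrite derive_coord_sum// [X in _ + X]big1 ?addr0// => k _.
  by rewrite /= vcoord_xdir mul0r.
have DvP i j p : 'D_(vdir j) (P i) p =
    \sum_k vcoord k p * 'D_(vdir j) (m i k) p + m i j p.
  rewrite derive_coord_sum//; congr (_ + _).
  rewrite (bigD1 j)//= vcoord_vdir eqxx mul1r big1 ?addr0// => k kj.
  by rewrite vcoord_vdir (negPf kj) mul0r.
have Dvm i j k p : partial j (fun w => M (col ord0 p.2) w i k) (col ord_max p.2) =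
    'D_(vdir j) (m i k) p.
  exact: (partial_velocity (fun _ x v => M x v i k)).
have Dxm i j k p : partial j (fun y => M y (col ord_max p.2) i k) (col ord0 p.2) =
    'D_(xdir j) (m i k) p.
  exact: (partial_position (fun _ x v => M x v i k)).
have DvF i j p : partial j (fun w => f p.1 (col ord0 p.2) w i 0) (col ord_max p.2) =
    'D_(vdir j) (F i) p.
  exact: (partial_velocity (fun t x v => f t x v i 0)).
have DxF i j p : partial j (fun y => f p.1 y (col ord_max p.2) i 0) (col ord0 p.2) =
    'D_(xdir j) (F i) p.
  exact: (partial_position (fun t x v => f t x v i 0)).
have colv k (p : E) : col ord_max p.2 k 0 = vcoord k p by rewrite mxE.
have H1' i j : 'D_(vdir j) (P i) =1 'D_(vdir i) (P j).
  move=> p; rewrite (DvP i j) (DvP j i); congr (_ + _); last first.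
    by rewrite /m /on_jets -[in LHS]M_sym mxE.
  have S a b : \sum_k vcoord k p * 'D_(vdir b) (m a k) p = \sum_(k < n)
      partial b (fun w => M (col ord0 p.2) w a k) (col ord_max p.2) * col ord_max p.2 k 0.
    by apply: eq_bigr => k _; rewrite Dvm colv mulrC.
  apply: etrans (S i j) _; apply: etrans (esym (S j i)); exact: H1.
have H2' i j p : 'D_(xdir j) (P i) p + 'D_(xdir i) (P j) p =
    'D_(vdir j) (F i) p + 'D_(vdir i) (F j) p.
  rewrite -(DvF i j) -(DvF j i) -H2 (DxP i j) (DxP j i) -big_split.
  by apply: eq_bigr => k _ /=; rewrite (Dxm i j) (Dxm j i) colv [RHS]mulrC mulrDr.
(* The sum over k of the hypothesis is the total derivative of the sum, as
   ddt is a derivative along a fixed vector h. *)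
have H3' i j p h : contact p h -> 'D_h ('D_(xdir j) (P i)) p =
    'D_(xdir j) (F i) p - 'D_(xdir i) (F j) p + 'D_h ('D_(vdir i) (F j)) p.
  move=> ph; rewrite -(DxF i j) -(DxF j i).
  have jF : on_jets (fun t x v => partial i (fun w => f t x w j 0) v) = 'D_(vdir i) (F j).
    by apply/funext => q; exact: DvF.
  have jm k : on_jets (fun _ x v => partial j (fun y => M y v i k) x * v k 0) =
      (fun q => vcoord k q * 'D_(xdir j) (m i k) q).
    by apply/funext => q; rewrite /on_jets Dxm colv mulrC.
  have sjm k : smooth (fun q => vcoord k q * 'D_(xdir j) (m i k) q).
    apply: smooth_mul; last exact: smooth_derive.
    exact/smooth_linear/jet_linear_continuous.
  rewrite -jF -ddt_contact//; last first.
    by rewrite jF; apply/smooth_differentiable/smooth_derive.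
  rewrite -H3 (funext (DxP i j)) derive_smooth_sum//.
  apply: eq_bigr => k _; rewrite ddt_contact// jm//.
  exact: smooth_differentiable.
have [L sL EL] := helmholtz_lagrangian sP sF H1' H2' H3'.
exists 1, (fun t w => L (t, w)); split.
  by rewrite (_ : (fun p => _) = L)//; apply/funext => -[].
right => i t u; rewrite euler_lagrange_first_order//.
have ph := prolongation_contact t u; apply: etrans (EL i _ _ ph) _.
have u0 (w : nat -> 'cV[R]_n) : col ord0 (jet 1 w) = w 0.
  by apply/colP => k; rewrite !mxE.
have u1 (w : nat -> 'cV[R]_n) : col ord_max (jet 1 w) = w 1.
  by apply/colP => k; rewrite !mxE.
have jP : on_jets (fun _ y w => (M y w *m w) i 0) = P i.
  by apply/funext => q; rewrite /on_jets mxE; apply: eq_bigr => k _; rewrite colv mulrC.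
have dP : differentiable (on_jets (fun _ y w => (M y w *m w) i 0)) (t, jet 1 u).
  by rewrite jP; exact: smooth_differentiable.
rewrite mxE; congr (- (_ - _)); last by rewrite /F /on_jets /= u0 u1.
rewrite -jP -(ddt_contact dP ph) /=.
by rewrite u0 !u1.
Qed.
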